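(* Let $n\ge3$ and let $A$ be a complex $n\times n$ matrix whose eigenvalues are all real. Let $\nu(A)$ be an eigenvalue of $A$ and denote the remaining $n-1$ eigenvalues (counted with multiplicity) by $\nu_1(A)\le\nu_2(A)\le\dots\le\nu_{n-1}(A)$. Then $$\frac{\operatorname{tr}A-\nu(A)}{n-1}-\sqrt{n-2}\,s_\nu\le\nu_1(A)\le\frac{\operatorname{tr}A-\nu(A)}{n-1}-\frac{s_\nu}{\sqrt{n-2}}$$ and $$\frac{\operatorname{tr}A-\nu(A)}{n-1}+\frac{s_\nu}{\sqrt{n-2}}\le\nu_{n-1}(A)\le\frac{\operatorname{tr}A-\nu(A)}{n-1}+\sqrt{n-2}\,s_\nu .$$
   Context: Here $s_\nu\ge0$ is the standard deviation of the remaining eigenvalues: $s_\nu^2=\frac1{n-1}\sum_{i=1}^{n-1}\left(\nu_i(A)-\overline\nu(A)\right)^2$, where $\overline\nu(A)=\frac1{n-1}\sum_{i=1}^{n-1}\nu_i(A)$. *)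

(* Defs.v *)
From mathcomp Require Import all_boot all_order all_algebra.
From mathcomp Require Import reals complex.
Set Implicit Arguments.
Unset Strict Implicit.
Unset Printing Implicit Defensive.
Import Order.TTheory GRing.Theory Num.Theory.
Local Open Scope ring_scope.

(* [s] enumerates the eigenvalues of [A], each repeated according to its
   algebraic multiplicity. *)
Definition is_spectrum (C : fieldType) (n : nat) (A : 'M[C]_n) (s : seq C) :=
  char_poly A = \prod_(x <- s) ('X - x%:P).

Definition mean (C : numClosedFieldType) (s : seq C) : C :=
  (\sum_(x <- s) x) / (size s)%:R.

(* Intended for lists of real numbers: the variance is then a nonnegative real,
   so that [sqrtC] is its nonnegative square root. *)
Definition sdev (C : numClosedFieldType) (s : seq C) : C :=
  sqrtC ((\sum_(x <- s) (x - mean s) ^+ 2) / (size s)%:R).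

(* Main.v *)
Require Import Defs.
From mathcomp Require Import all_boot all_order all_algebra.
From mathcomp Require Import reals complex.
From mathcomp Require Import ring.
Set Implicit Arguments.
Unset Strict Implicit.
Unset Printing Implicit Defensive.
Import Order.TTheory GRing.Theory Num.Theory.
Local Open Scope ring_scope.

(** The trace of A is the sum of its eigenvalues, so (tr A - nu) / (n - 1) is
    the mean of the remaining ones, and the theorem is about a list s of
    m = n - 1 >= 2 real numbers with mean c and standard deviation sigma: it
    locates the least and the greatest entry of s.

    Everything follows from the parallel axis identity [sum_sqr_shift]:
    the sum of (x - a)^2 over s is m sigma^2 + m (c - a)^2, for every a.

    Outer bounds, valid for each entry x of s ([dist_mean_le]): take for a the
    mean c - (x - c) / (m - 1) of the other entries, and drop the
    term of x from the sum.  What remains is a sum of squares, and it equals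
    m (sigma^2 - (x - c)^2 / (m - 1)); hence |x - c| <= sqrt (m - 1) sigma.

    Inner bounds ([sdev_le_mean_sub]): if a is a lower bound of s, the
    numbers x - a are nonnegative, so their squares sum to at most
    the square of their sum, (m (c - a))^2; hence
    sigma <= sqrt (m - 1) (c - a).  Upper bounds reduce to lower bounds by
    negating all the entries. *)

Section RealLists.
Variable C : numClosedFieldType.
Implicit Types (s : seq C) (x a : C).

Lemma sum_eq_mean s : (0 < size s)%N ->
  \sum_(x <- s) x = (size s)%:R * mean s.
Proof.
move=> s_gt0; rewrite /mean mulrC divfK //.
by rewrite pnatr_eq0 -lt0n.
Qed.

Lemma sum_sqr_sub_mean s : (0 < size s)%N ->
  \sum_(x <- s) (x - mean s) ^+ 2 = (size s)%:R * sdev s ^+ 2.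
Proof.
move=> s_gt0; rewrite /sdev sqrtCK mulrC divfK //.
by rewrite pnatr_eq0 -lt0n.
Qed.

Lemma sum_const s x : \sum_(y <- s) x = (size s)%:R * x.
Proof. by rewrite big_const_seq count_predT iter_addr_0 mulr_natl. Qed.

(** The parallel axis identity: the cross term vanishes because the deviations
    from the mean sum to zero. *)
Lemma sum_sqr_shift s a : (0 < size s)%N ->
  \sum_(x <- s) (x - a) ^+ 2
    = (size s)%:R * sdev s ^+ 2 + (size s)%:R * (mean s - a) ^+ 2.
Proof.
move=> s_gt0; rewrite -sum_sqr_sub_mean //.
transitivity (\sum_(x <- s) ((x - mean s) ^+ 2
    + (2%:R * (mean s - a) * (x - mean s) + (mean s - a) ^+ 2))).
  by apply: eq_bigr => x _; ring.
rewrite !big_split /= -mulr_sumr sumrB sum_eq_mean // !sum_const.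
by rewrite subrr mulr0 add0r.
Qed.

Lemma mean_real s : all (mem Num.real) s -> mean s \is Num.real.
Proof.
move=> /allP sR; apply: rpredM; last by rewrite rpredV realn.
by rewrite big_seq; apply: rpred_sum => x /sR.
Qed.

Lemma sdev_ge0 s : all (mem Num.real) s -> 0 <= sdev s.
Proof.
move=> sR; rewrite sqrtC_ge0 divr_ge0 ?ler0n // big_seq.
apply: sumr_ge0 => x /(allP sR) xR.
by rewrite -realEsqr rpredB ?mean_real.
Qed.

Lemma sum_nonneg_sqr_le s : all (>= 0) s ->
  \sum_(x <- s) x ^+ 2 <= (\sum_(x <- s) x) ^+ 2.
Proof.
elim: s => [|x s IHs] /=; first by rewrite !big_nil expr0n.
case/andP=> x_ge0 s_ge0; rewrite !big_cons sqrrD -addrA lerD2l.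
have sum_ge0 : 0 <= \sum_(y <- s) y.
  by rewrite big_seq; apply: sumr_ge0 => y /(allP s_ge0).
by rewrite (le_trans (IHs s_ge0)) // lerDr mulrn_wge0 ?mulr_ge0.
Qed.

(** Samuelson's inequality: around the mean b of the other entries, the squares
    of the entries other than x have a nonnegative sum, which the parallel axis
    identity computes. *)
Lemma dist_mean_le s x : (1 < size s)%N -> all (mem Num.real) s -> x \in s ->
  `|x - mean s| <= sqrtC (size s - 1)%:R * sdev s.
Proof.
move=> s_gt1 sR xs; have s_gt0 := ltnW s_gt1.
have cR := mean_real sR; have xR : x \is Num.real := allP sR x xs.
have k_gt0 : 0 < (size s - 1)%:R :> C by rewrite ltr0n subn_gt0.
have m_gt0 : 0 < (size s)%:R :> C by rewrite ltr0n.
have m_eq : (size s)%:R = (size s - 1)%:R + 1 :> C by rewrite natr1 subn1 prednK.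
rewrite -ler_sqr ?nnegrE ?mulr_ge0 ?sdev_ge0 ?sqrtC_ge0 ?ler0n //.
rewrite real_normK ?rpredB // exprMn sqrtCK.
set k := (size s - 1)%:R in k_gt0 m_eq *.
(* The mean of the entries other than x. *)
pose b := mean s - (x - mean s) / k.
have bR : b \is Num.real.
  apply: rpredB => //; apply: rpredM; first exact: rpredB.
  by rewrite rpredV gtr0_real.
have others_ge0 : 0 <= \sum_(y <- rem x s) (y - b) ^+ 2.
  rewrite big_seq; apply: sumr_ge0 => y /mem_rem ys; have yR : y \is Num.real := allP sR y ys.
  by rewrite -realEsqr rpredB.
have := sum_sqr_shift b s_gt0; rewrite (perm_big _ (perm_to_rem xs)) big_cons.
have -> : (size s)%:R * sdev s ^+ 2 + (size s)%:R * (mean s - b) ^+ 2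
    = (x - b) ^+ 2 + (size s)%:R / k * (k * sdev s ^+ 2 - (x - mean s) ^+ 2).
  by rewrite m_eq /b; field; exact: lt0r_neq0.
move=> /addrI others_eq; move: others_ge0.
by rewrite others_eq pmulr_rge0 ?divr_gt0 // subr_ge0.
Qed.

(** Among nonnegative numbers of given total, the sum of squares is largest when
    at most one of them is nonzero; so the extreme case is a list whose entries
    all equal a, except one. *)
Lemma sdev_le_mean_sub s a : (1 < size s)%N -> all (mem Num.real) s ->
  all (>= a) s -> sdev s / sqrtC (size s - 1)%:R <= mean s - a.
Proof.
move=> s_gt1 sR s_ge; have s_gt0 := ltnW s_gt1.
have k_gt0 : 0 < (size s - 1)%:R :> C by rewrite ltr0n subn_gt0.
have m_gt0 : 0 < (size s)%:R :> C by rewrite ltr0n.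
have m_eq : (size s)%:R = (size s - 1)%:R + 1 :> C by rewrite natr1 subn1 prednK.
have shift_ge0 : all (>= 0) [seq x - a | x <- s].
  by rewrite all_map; apply: sub_all s_ge => x /=; rewrite subr_ge0.
have sum_shift : \sum_(x <- s) (x - a) = (size s)%:R * (mean s - a).
  by rewrite sumrB sum_eq_mean // sum_const mulrBr.
have gap_ge0 : 0 <= mean s - a.
  rewrite -(pmulr_rge0 _ m_gt0) -sum_shift big_seq.
  by apply: sumr_ge0 => x /(allP s_ge) /=; rewrite subr_ge0.
rewrite ler_pdivrMr ?sqrtC_gt0 //.
rewrite -ler_sqr ?nnegrE ?mulr_ge0 ?sdev_ge0 ?sqrtC_ge0 ?ler0n //.
rewrite exprMn (sqrtCK (size s - 1)%:R).
have := sum_nonneg_sqr_le shift_ge0.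
rewrite !big_map sum_shift (sum_sqr_shift a) // -[X in is_true X -> _]subr_ge0.
set k := (size s - 1)%:R in m_eq *.
have -> : ((size s)%:R * (mean s - a)) ^+ 2
    - ((size s)%:R * sdev s ^+ 2 + (size s)%:R * (mean s - a) ^+ 2)
    = (size s)%:R * ((mean s - a) ^+ 2 * k - sdev s ^+ 2).
  by rewrite m_eq; ring.
by rewrite pmulr_rge0 // subr_ge0.
Qed.

Lemma mean_opp s : mean [seq - x | x <- s] = - mean s.
Proof. by rewrite /mean big_map size_map sumrN mulNr. Qed.

Lemma sdev_opp s : sdev [seq - x | x <- s] = sdev s.
Proof.
rewrite /sdev big_map size_map mean_opp; congr (sqrtC (_ / _)).
by apply: eq_bigr => x _; rewrite -opprD sqrrN.
Qed.

Lemma sdev_le_sub_mean s a : (1 < size s)%N -> all (mem Num.real) s ->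
  all (<= a) s -> sdev s / sqrtC (size s - 1)%:R <= a - mean s.
Proof.
move=> s_gt1 sR s_le.
have /= := @sdev_le_mean_sub [seq - x | x <- s] (- a).
rewrite size_map mean_opp sdev_opp opprK addrC; apply=> //; rewrite all_map.
  by apply: sub_all sR => x xR; apply: rpredNr.
by apply: sub_all s_le => x /=; rewrite lerN2.
Qed.

End RealLists.

(** Compare the coefficients of degree n - 1 of the characteristic
    polynomial. *)
Lemma trace_spectrum (F : fieldType) n (A : 'M[F]_n) (s : seq F) :
  (0 < n)%N -> is_spectrum A s -> \tr A = \sum_(x <- s) x.
Proof.
move=> n_gt0 As.
have size_s : size s = n.
  by apply: succn_inj; rewrite -(size_prod_XsubC s id) -As size_char_poly.
apply: oppr_inj; rewrite -char_poly_trace // As -size_s.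
by rewrite coefPn_prod_XsubC // size_s -lt0n.
Qed.

Lemma eigenvalue_spectrum (F : fieldType) n (A : 'M[F]_n) (s : seq F) a :
  is_spectrum A s -> eigenvalue A a = (a \in s).
Proof. by move=> As; rewrite eigenvalue_root_char As root_prod_XsubC. Qed.

(* Inequalities are in the order of R[i]: x <= y means that y - x is a
   nonnegative real.  Indices are 0-based: nus`_0 is nu_1, nus`_(n - 2) is
   nu_(n-1). *)
Theorem theorem3p3 (R : realType) (n : nat) (hn : (3 <= n)%N)
    (A : 'M[R[i]]_n)
    (hreal : forall a : R[i], eigenvalue A a -> a \is Num.real)
    (nu : R[i]) (hnu : eigenvalue A nu)
    (nus : (n - 1).-tuple R[i])
    (hnus : is_spectrum A (nu :: nus))
    (hsort : sorted <=%R nus) :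
  ((\tr A - nu) / (n - 1)%:R - sqrtC (n - 2)%:R * sdev nus <= nus`_0
     <= (\tr A - nu) / (n - 1)%:R - sdev nus / sqrtC (n - 2)%:R)
  /\
  ((\tr A - nu) / (n - 1)%:R + sdev nus / sqrtC (n - 2)%:R <= nus`_(n - 2)
     <= (\tr A - nu) / (n - 1)%:R + sqrtC (n - 2)%:R * sdev nus).
Proof.
have size_nus : size nus = (n - 1)%N := size_tuple nus.
have nus_gt1 : (1 < size nus)%N by rewrite size_nus ltn_subRL.
have nusR : all (mem Num.real) nus.
  apply/allP => x x_nus; apply: hreal.
  by rewrite (eigenvalue_spectrum _ hnus) in_cons x_nus orbT.
have -> : (\tr A - nu) / (n - 1)%:R = mean nus.
  rewrite (trace_spectrum _ hnus) ?(leq_trans _ hn) //.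
  by rewrite big_cons [nu + _]addrC addrK /mean size_nus.
have last_eq : (n - 2)%N = (size nus - 1)%N by rewrite size_nus -subnDA.
have last_lt : (size nus - 1 < size nus)%N by rewrite ltn_subrL (ltnW nus_gt1).
rewrite last_eq.
have nth_le := sorted_leq_nth le_trans le_refl (0 : R[i]) hsort.
have first_le : all (>= nus`_0) nus.
  apply/(all_nthP 0) => i i_lt /=.
  by apply: nth_le; rewrite ?inE // (ltnW nus_gt1).
have le_last : all (<= nus`_(size nus - 1)) nus.
  apply/(all_nthP 0) => i i_lt /=; apply: nth_le; rewrite ?inE //.
  by rewrite -ltnS subn1 prednK ?(ltnW nus_gt1).
have outer i : (i < size nus)%N -> mean nus - sqrtC (size nus - 1)%:R * sdev nus
    <= nus`_i <= mean nus + sqrtC (size nus - 1)%:R * sdev nus.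
  move=> i_lt; have nth_in := mem_nth 0 i_lt.
  have nthR : nus`_i \is Num.real := allP nusR _ nth_in.
  by rewrite -real_ler_distl ?dist_mean_le // rpredB // mean_real.
split.
- have /andP[-> _] := outer 0%N (ltnW nus_gt1).
  by rewrite lerBrDr addrC -lerBrDr sdev_le_mean_sub.
- have /andP[_ ->] := outer _ last_lt.
  by rewrite andbT addrC -lerBrDr sdev_le_sub_mean.
Qed.
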